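(* Let $\mathcal K\subseteq\mathcal H$ be a nonzero collecting subspace that contains no nonzero proper subspace which is collecting. Then there exists exactly one $\rho\in\mathbf S$ with $\rho=P_{\mathcal K}\rho P_{\mathcal K}$ and $\mathcal D(\rho)=0$, and this $\rho$ satisfies $\mathrm{rank}(\rho)=\dim\mathcal K$.
   Context: Let $\mathcal H$ be a finite-dimensional complex Hilbert space, $H=H^\dagger$ and $\{h_\alpha\}$ a finite family of operators on $\mathcal H$, $\mathcal D(\rho)=-i[H,\rho]+\sum_\alpha(h_\alpha\rho h_\alpha^\dagger-\tfrac12(h_\alpha^\dagger h_\alpha\rho+\rho h_\alpha^\dagger h_\alpha))$, $\mathcal T^t=e^{t\mathcal D}$. $\mathbf S$ is the set of density matrices; $P_{\mathcal K}$ is the orthogonal projector onto $\mathcal K$. A subspace $P\mathcal H$ ($P$ an orthogonal projector) is collecting if $\mathcal T^t(P\sigma P)=P\,\mathcal T^t(P\sigma P)\,P$ for all $t>0$ and all operators $\sigma$ (in particular every enclosure, i.e. a subspace whose projector commutes with $H$ and all $h_\alpha$, is collecting). *)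

(* Defs.v *)
From Stdlib Require Import Reals List Factorial.
Open Scope R_scope.

Definition C := (R * R)%type.
Definition Cre (z : C) : R := fst z.
Definition Cim (z : C) : R := snd z.
Definition C0 : C := (0, 0).
Definition C1 : C := (1, 0).
Definition Ci : C := (0, 1).
Definition Cadd (z w : C) : C := (fst z + fst w, snd z + snd w).
Definition Copp (z : C) : C := (- fst z, - snd z).
Definition Cmul (z w : C) : C :=
  (fst z * fst w - snd z * snd w, fst z * snd w + snd z * fst w).
Definition Cconj (z : C) : C := (fst z, - snd z).
Definition RtoC (r : R) : C := (r, 0).

Fixpoint Csum (m : nat) (f : nat -> C) : C :=
  match m with
  | O => C0
  | S m' => Cadd (Csum m' f) (f m')
  end.

Definition Mat := nat -> nat -> C.
Definition Vec := nat -> C.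

Definition Mzero : Mat := fun _ _ => C0.
Definition Madd (A B : Mat) : Mat := fun i j => Cadd (A i j) (B i j).
Definition Msub (A B : Mat) : Mat := fun i j => Cadd (A i j) (Copp (B i j)).
Definition Mscal (c : C) (A : Mat) : Mat := fun i j => Cmul c (A i j).
Definition Mmul (n : nat) (A B : Mat) : Mat :=
  fun i j => Csum n (fun k => Cmul (A i k) (B k j)).
Definition Madj (A : Mat) : Mat := fun i j => Cconj (A j i).
Definition Mtrace (n : nat) (A : Mat) : C := Csum n (fun i => A i i).
Definition Mapply (n : nat) (A : Mat) (x : Vec) : Vec :=
  fun i => Csum n (fun k => Cmul (A i k) (x k)).

Definition meq (n : nat) (A B : Mat) : Prop :=
  forall i j, (i < n)%nat -> (j < n)%nat -> A i j = B i j.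
Definition veq (n : nat) (x y : Vec) : Prop :=
  forall i, (i < n)%nat -> x i = y i.

Definition hermitian (n : nat) (A : Mat) : Prop := meq n (Madj A) A.

Definition orth_proj (n : nat) (P : Mat) : Prop :=
  hermitian n P /\ meq n (Mmul n P P) P.

Definition psd (n : nat) (A : Mat) : Prop :=
  forall x : Vec,
    0 <= Cre (Csum n (fun i => Cmul (Cconj (x i)) (Mapply n A x i))).
Definition density (n : nat) (rho : Mat) : Prop :=
  hermitian n rho /\ psd n rho /\ Mtrace n rho = C1.

Definition dissip_term (n : nat) (h rho : Mat) : Mat :=
  Msub (Mmul n (Mmul n h rho) (Madj h))
       (Mscal (RtoC (/2))
          (Madd (Mmul n (Mmul n (Madj h) h) rho)
                (Mmul n rho (Mmul n (Madj h) h)))).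

Definition Lind (n : nat) (H : Mat) (hs : list Mat) (rho : Mat) : Mat :=
  fold_right (fun h acc => Madd acc (dissip_term n h rho))
    (Mscal (Copp Ci) (Msub (Mmul n H rho) (Mmul n rho H))) hs.

Fixpoint Lind_iter (n : nat) (H : Mat) (hs : list Mat) (k : nat) (X : Mat) : Mat :=
  match k with
  | O => X
  | S k' => Lind n H hs (Lind_iter n H hs k' X)
  end.

Fixpoint exp_partial (n : nat) (H : Mat) (hs : list Mat) (t : R) (N : nat) (X : Mat) : Mat :=
  match N with
  | O => X
  | S N' => Madd (exp_partial n H hs t N' X)
                 (Mscal (RtoC (t ^ N / INR (Factorial.fact N))) (Lind_iter n H hs N X))
  end.

Definition is_semigroup_image (n : nat) (H : Mat) (hs : list Mat) (t : R) (X Y : Mat) : Prop :=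
  forall i j, (i < n)%nat -> (j < n)%nat ->
    Un_cv (fun N => Cre (exp_partial n H hs t N X i j)) (Cre (Y i j)) /\
    Un_cv (fun N => Cim (exp_partial n H hs t N X i j)) (Cim (Y i j)).

(* collecting subspace (given by its orthogonal projector P) *)
Definition collecting (n : nat) (H : Mat) (hs : list Mat) (P : Mat) : Prop :=
  forall (t : R) (sigma Y : Mat), 0 < t ->
    is_semigroup_image n H hs t (Mmul n (Mmul n P sigma) P) Y ->
    meq n (Mmul n (Mmul n P Y) P) Y.

(* range(Q) is contained in range(P), for orthogonal projectors *)
Definition subspace_of (n : nat) (Q P : Mat) : Prop := meq n (Mmul n P Q) Q.

Definition in_range (n : nat) (A : Mat) (v : Vec) : Prop :=
  exists x : Vec, veq n (Mapply n A x) v.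

Definition lin_indep (n m : nat) (vs : nat -> Vec) : Prop :=
  forall c : nat -> C,
    veq n (fun i => Csum m (fun k => Cmul (c k) (vs k i))) (fun _ => C0) ->
    forall k, (k < m)%nat -> c k = C0.

Definition is_rank (n : nat) (A : Mat) (r : nat) : Prop :=
  (exists vs : nat -> Vec,
      (forall k, (k < r)%nat -> in_range n A (vs k)) /\ lin_indep n r vs) /\
  (forall (m : nat) (vs : nat -> Vec),
      (forall k, (k < m)%nat -> in_range n A (vs k)) -> lin_indep n m vs ->
      (m <= r)%nat).

(* Main.v *)
From Stdlib Require Import Reals List Lra Lia.
Open Scope R_scope.

(** A collecting subspace is the range of a projector P such that the generator
    D maps P M P into itself: the semigroup t |-> T^t (P s P) is a power series
    whose first-order coefficient is D (P s P).

    Write D X = K X + X K^† + sum_h h X h^† with K + K^† = - sum_h h^† h.  As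
    D has traceless values, it is not onto, hence not injective, on P M P; this
    gives a nonzero Hermitian stationary X in P M P.  Split X = S S - T T with
    S T = 0.  Comparing the traces of D (S S) = D (T T) in the corners cut out
    by the range projector p of S shows that all h preserve the ranges of S and
    T; what remains of D (S S) is the corner A = p D (S S) (1 - p), and the
    dissipation identity turns into the Sylvester equation A T T + S S A = 0,
    which forces A = 0.  So the positive and negative parts of a stationary X
    are stationary.  The range of a positive stationary operator is collecting,
    so by minimality it is the range of P or 0.  Two distinct stationary states
    would yield a traceless X whose parts are both nonzero, hence two orthogonal
    ranges both equal to that of P. *)

(** * Exponential series *)

Definition expcoef (t : R) (k : nat) : R := t ^ k / INR (Factorial.fact k).

Lemma expcoef_ge0 t k : 0 <= t -> 0 <= expcoef t k.
Proof.
intro t0; apply Rmult_le_pos; [now apply pow_le|].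
apply Rlt_le, Rinv_0_lt_compat, INR_fact_lt_0.
Qed.

Lemma expcoef_series t : Un_cv (sum_f_R0 (expcoef t)) (exp t).
Proof.
unfold exp; destruct (exist_exp t) as [l E]; simpl.
intros eps epos; destruct (E eps epos) as [N HN]; exists N; intros m Hm.
rewrite (sum_eq _ (fun i => / INR (Factorial.fact i) * t ^ i)); [now apply HN|].
intros i _; unfold expcoef, Rdiv; ring.
Qed.

Lemma expcoef_series_le t N : 0 <= t -> sum_f_R0 (expcoef t) N <= exp t.
Proof.
intro t0; apply sum_incr; [apply expcoef_series|].
now intro k; apply expcoef_ge0.
Qed.

Lemma Un_cv_const (c : R) : Un_cv (fun _ => c) c.
Proof.
intros eps epos; exists 0%nat; intros m _.
now unfold Rdist; rewrite Rminus_diag, Rabs_R0.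
Qed.

Section ExpSeries.
Variables (a : nat -> R) (B M : R).
Hypotheses (M_ge0 : 0 <= M) (a_le : forall k, Rabs (a k) <= B * M ^ k).

Lemma expcoef_bound t k : 0 <= t ->
  Rabs (expcoef t k * a k) <= B * expcoef (t * M) k.
Proof.
intro t0; rewrite Rabs_mult, (Rabs_pos_eq (expcoef t k)) by now apply expcoef_ge0.
replace (B * expcoef (t * M) k) with (expcoef t k * (B * M ^ k)).
  now apply Rmult_le_compat_l; [apply expcoef_ge0 | apply a_le].
unfold expcoef, Rdiv; rewrite Rpow_mult_distr; ring.
Qed.

(** Absolute convergence, by comparison with [B] times the series of [exp (t * M)]. *)
Lemma exp_series_cv t : 0 <= t ->
  {l : R | Un_cv (sum_f_R0 (fun k => expcoef t k * a k)) l}.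
Proof.
intro t0; apply cv_cauchy_2, cauchy_abs, cv_cauchy_1.
apply Rseries_CV_comp with (Bn := fun k => B * expcoef (t * M) k).
  now intro k; split; [apply Rabs_pos | apply expcoef_bound].
exists (exp (t * M) * B).
intros eps epos.
destruct (CV_mult _ (fun _ => B) _ _ (expcoef_series (t * M))
  (Un_cv_const B) eps epos) as [N HN].
exists N; intros m Hm; rewrite (sum_eq _ (fun k => expcoef (t * M) k * B)).
  now rewrite <- scal_sum, Rmult_comm; apply HN.
intros; ring.
Qed.

(** For [t <= 1] and [k >= 2] one has [t ^ k <= t * t], so all terms past the linear one are
    dominated by [t * t * B] times the terms of the series of [exp M]. *)
Lemma exp_series_remainder t N : 0 <= t <= 1 -> a 0%nat = 0 ->
  Rabs (sum_f_R0 (fun k => expcoef t k * a k) (S N) - t * a 1%nat)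
  <= t * t * B * sum_f_R0 (expcoef M) (S N).
Proof.
intros [t0 t1] a0; induction N as [|N IH].
- replace (_ - _) with 0.
    rewrite Rabs_R0.
    assert (0 <= B) by (pose proof (Rabs_pos (a 0%nat)); pose proof (a_le 0%nat); simpl in *; lra).
    apply Rmult_le_pos; [apply Rmult_le_pos; [nra|easy]|].
    now apply cond_pos_sum; intro; apply expcoef_ge0.
  unfold expcoef; simpl; rewrite a0; field.
- rewrite tech5, (tech5 (expcoef M)), Rmult_plus_distr_l.
  replace (_ + _ - _) with
    ((sum_f_R0 (fun k => expcoef t k * a k) (S N) - t * a 1%nat)
     + expcoef t (S (S N)) * a (S (S N))) by ring.
  eapply Rle_trans; [apply Rabs_triang|]; apply Rplus_le_compat; [exact IH|].
  rewrite Rabs_mult, (Rabs_pos_eq (expcoef t _)) by now apply expcoef_ge0.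
  replace (t * t * B * expcoef M (S (S N)))
    with (t * t / INR (Factorial.fact (S (S N))) * (B * M ^ S (S N)))
    by (unfold expcoef, Rdiv; ring).
  apply Rmult_le_compat; [now apply expcoef_ge0 | apply Rabs_pos | | apply a_le].
  apply Rmult_le_compat_r; [apply Rlt_le, Rinv_0_lt_compat, INR_fact_lt_0|].
  assert (tN : t ^ N <= 1) by (rewrite <- (pow1 N); now apply pow_incr).
  simpl; pose proof (pow_le t N t0); nra.
Qed.

(* Only the derivative at 0 is used: the remainder is O(t^2). *)
Lemma exp_series_coef1_eq0 : a 0%nat = 0 ->
  (forall t, 0 < t -> Un_cv (sum_f_R0 (fun k => expcoef t k * a k)) 0) ->
  a 1%nat = 0.
Proof.
intros a0 cv0.
assert (B0 : 0 <= B) by (pose proof (Rabs_pos (a 0%nat)); pose proof (a_le 0%nat); simpl in *; lra).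
assert (E0 := exp_pos M).
assert (le_t : forall t, 0 < t <= 1 -> Rabs (a 1%nat) <= t * (B * exp M + 1)).
{ intros t [t0 t1].
  (* The precision [t * t] matches the order of the remainder. *)
  destruct (cv0 t t0 (t * t)) as [N HN]; [nra|].
  assert (SN : Rabs (sum_f_R0 (fun k => expcoef t k * a k) (S N)) < t * t).
  { rewrite <- (Rminus_0_r (sum_f_R0 _ _)); apply HN; unfold ge; lia. }
  assert (RN := exp_series_remainder t N (conj (Rlt_le _ _ t0) t1) a0).
  assert (SM := expcoef_series_le M (S N) M_ge0).
  assert (tt : t * t * B * sum_f_R0 (expcoef M) (S N) <= t * t * B * exp M)
    by (apply Rmult_le_compat_l; [apply Rmult_le_pos; nra | exact SM]).
  assert (T : Rabs (t * a 1%nat) <= t * t * B * exp M + t * t).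
  { replace (t * a 1%nat) with (sum_f_R0 (fun k => expcoef t k * a k) (S N)
      - (sum_f_R0 (fun k => expcoef t k * a k) (S N) - t * a 1%nat)) by ring.
    eapply Rle_trans; [apply Rabs_triang|]; rewrite Rabs_Ropp; lra. }
  rewrite Rabs_mult, (Rabs_pos_eq t) in T by lra.
  apply Rmult_le_reg_l with t; [easy|]; lra. }
destruct (Req_dec (a 1%nat) 0) as [|n0]; [easy|exfalso].
assert (p0 := Rabs_pos_lt _ n0); set (x := Rabs (a 1%nat)) in *.
set (D := B * exp M + 1) in *.
assert (D1 : 1 <= D) by (unfold D; pose proof (Rmult_le_pos B (exp M) B0); lra).
assert (x1 := le_t 1 ltac:(lra)).
(* At [t = x / (2 * D)] the bound [x <= t * D] reads [x <= x / 2]; [x1] guarantees that this [t] is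
   at most 1. *)
assert (q : 0 < x / (2 * D)) by (apply Rdiv_lt_0_compat; lra).
assert (q1 : x / (2 * D) * D = x / 2) by (field; lra).
specialize (le_t (x / (2 * D))); nra.
Qed.
End ExpSeries.

From HB Require Import structures.
From mathcomp Require Import all_boot all_order all_algebra Rstruct.
From mathcomp.real_closed Require Import complex.
(* Last, so that [hermitian] is the one of Defs and not that of sesquilinear. *)
Require Import Defs.

Set Implicit Arguments. Unset Strict Implicit. Unset Printing Implicit Defensive.
Import Order.TTheory GRing.Theory Num.Theory.
Local Open Scope ring_scope.
Local Open Scope sesquilinear_scope.

Reserved Notation "A ^†" (at level 8, format "A ^†").

(** * Adjoints and positive parts *)

Section Adjoint.
Variable F : numClosedFieldType.

Definition adjmx m n (A : 'M[F]_(m, n)) : 'M[F]_(n, m) := A^t*.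
Local Notation "A ^†" := (adjmx A).

Lemma adjmxE m n (A : 'M[F]_(m, n)) i j : A^† i j = (A j i)^*.
Proof. by rewrite !mxE. Qed.

Lemma adjmxK m n (A : 'M[F]_(m, n)) : A^†^† = A.
Proof. exact: trmxCK. Qed.

Lemma adjmxM m n p (A : 'M[F]_(m, n)) (B : 'M_(n, p)) : (A *m B)^† = B^† *m A^†.
Proof. by rewrite /adjmx trmx_mul map_mxM. Qed.

Lemma adjmxD m n (A B : 'M[F]_(m, n)) : (A + B)^† = A^† + B^†.
Proof. by rewrite /adjmx !raddfD. Qed.

Lemma adjmxN m n (A : 'M[F]_(m, n)) : (- A)^† = - A^†.
Proof. by rewrite /adjmx !raddfN. Qed.

Lemma adjmxZ m n a (A : 'M[F]_(m, n)) : (a *: A)^† = a^* *: A^†.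
Proof. by apply/matrixP => i j; rewrite !mxE rmorphM. Qed.

Lemma adjmx1 n : (1%:M : 'M[F]_n)^† = 1%:M.
Proof. by rewrite /adjmx trmx1 map_mx1. Qed.

Lemma adjmx0 m n : (0 : 'M[F]_(m, n))^† = 0.
Proof. by rewrite /adjmx trmx0 map_mx0. Qed.

Lemma adjmx_sum m n I (r : seq I) (A : I -> 'M[F]_(m, n)) :
  (\sum_(i <- r) A i)^† = \sum_(i <- r) (A i)^†.
Proof. by rewrite (big_morph _ (@adjmxD m n) (@adjmx0 m n)). Qed.

(** This is the squared Frobenius norm; positivity and definiteness follow from it. *)
Lemma mxtrace_mul_adjE m n (A : 'M[F]_(m, n)) :
  \tr (A *m A^†) = \sum_i \sum_j `|A i j| ^+ 2.
Proof.
apply: eq_bigr => i _; rewrite mxE; apply: eq_bigr => j _.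
by rewrite adjmxE -normCK.
Qed.

Lemma mxtrace_mul_adj_ge0 m n (A : 'M[F]_(m, n)) : 0 <= \tr (A *m A^†).
Proof.
rewrite mxtrace_mul_adjE; apply: sumr_ge0 => i _; apply: sumr_ge0 => j _.
exact: exprn_ge0.
Qed.

Lemma mxtrace_mul_adj_eq0 m n (A : 'M[F]_(m, n)) : \tr (A *m A^†) = 0 -> A = 0.
Proof.
have ge0 i j : 0 <= `|A i j| ^+ 2 by exact: exprn_ge0.
have sge0 i : 0 <= \sum_j `|A i j| ^+ 2 by exact: sumr_ge0.
rewrite mxtrace_mul_adjE => /eqP; rewrite psumr_eq0 // => /allP tr0.
apply/matrixP => i j; rewrite mxE.
have /eqP/eqP := tr0 i (mem_index_enum i); rewrite psumr_eq0 // => /allP.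
by move=> /(_ j (mem_index_enum j)); rewrite sqrf_eq0 normr_eq0 => /eqP.
Qed.

(* G and E are the pseudo-inverses of S and T, so S *m G and T *m E are the
   orthogonal projectors onto the ranges of S *m S and T *m T. *)
Definition posneg_parts n (X S G T E : 'M[F]_n) :=
  [/\ S^† = S, G^† = G, T^† = T & E^† = E] /\
  [/\ X = S *m S - T *m T, S *m T = 0,
      S *m G *m S = S /\ S *m G = G *m S & T *m E *m T = T /\ T *m E = E *m T].

(** Diagonalise [X] in a unitary eigenbasis: [S] and [T] are the square roots of its positive and
    negative parts. *)
Lemma posneg_parts_exists n (X : 'M[F]_n) : X^† = X ->
  exists S G T E, posneg_parts X S G T E.
Proof.
move=> Xh; have Xhm : X \is hermsymmx.
  by apply/is_hermitianmxP; rewrite expr0 scale1r -[LHS]Xh.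
have /hermitian_normalmx/orthomx_spectralP := Xhm.
have dr := hermitian_spectral_diag_real Xhm.
set U := spectralmx X; set d := spectral_diag X in dr *.
rewrite invmx_unitary ?spectral_unitarymx // -/(adjmx U) => Xe.
have UU : U *m U^† = 1%:M by apply/unitarymxP/spectral_unitarymx.
(* Functional calculus of [X]: products of values of [f] are entrywise products of eigenvalue
   vectors, so each identity reduces to scalars. *)
pose f (v : 'rV[F]_n) := U^† *m diag_mx v *m U.
have fM v w : f v *m f w = f (\row_i (v 0 i * w 0 i)).
  rewrite /f -!mulmxA; congr (_ *m _); rewrite !mulmxA; congr (_ *m U).
  rewrite -[_ *m U *m _]mulmxA UU mulmx1 mulmx_diag.
  by congr diag_mx; apply/rowP => i; rewrite !mxE.
have fB v w : f v - f w = f (v - w).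
  by rewrite /f raddfB /= mulmxBr mulmxBl.
have fA v : v \is a realmx -> (f v)^† = f v.
  move=> vr; rewrite /f !adjmxM adjmxK mulmxA.
  by rewrite [in X in _ *m X *m _]/adjmx tr_diag_mx map_diag_mx realmxC.
have dR i : d 0 i \is Num.real by move/mxOverP: dr.
pose s : 'rV[F]_n := \row_i (if 0 <= d 0 i then sqrtC (d 0 i) else 0).
pose t : 'rV[F]_n := \row_i (if 0 <= d 0 i then 0 else sqrtC (- d 0 i)).
have s_ge0 i : 0 <= s 0 i by rewrite mxE; case: ifP; rewrite ?sqrtC_ge0.
have t_ge0 i : 0 <= t 0 i.
  by rewrite mxE; case: (real_ge0P (dR i)) => // di; rewrite sqrtC_ge0 oppr_ge0 ltW.
(* Since the inverse of 0 is 0, these entrywise inverses give pseudo-inverses. *)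
pose g : 'rV[F]_n := \row_i (s 0 i)^-1; pose e : 'rV[F]_n := \row_i (t 0 i)^-1.
exists (f s), (f g), (f t), (f e).
have rl (v : 'rV[F]_n) : (forall i, 0 <= v 0 i) -> v \is a realmx.
  by move=> vge; apply/mxOverP => i j; rewrite ord1 ger0_real.
have VK (x : F) : x * x^-1 * x = x.
  by have [->|x0] := eqVneq x 0; rewrite ?mulr0 // divfK.
split; first by split; apply/fA/rl => i //; rewrite mxE invr_ge0.
split.
- rewrite [LHS]Xe !fM fB; congr (_ *m diag_mx _ *m _).
  apply/rowP => i; rewrite !mxE -!expr2.
  by case: ifP; rewrite sqrtCK expr0n ?subr0 //= sub0r opprK.
- rewrite fM (_ : \row_i _ = 0); last first.
    by apply/rowP => i; rewrite !mxE; case: ifP; rewrite ?mulr0 ?mul0r.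
  by rewrite /f linear0 mulmx0 mul0mx.
- split; rewrite !fM; congr (_ *m diag_mx _ *m _); apply/rowP => i.
    by rewrite [LHS]mxE [X in X * _]mxE [g 0 i]mxE VK.
  by rewrite [LHS]mxE [RHS]mxE mulrC.
- split; rewrite !fM; congr (_ *m diag_mx _ *m _); apply/rowP => i.
    by rewrite [LHS]mxE [X in X * _]mxE [e 0 i]mxE VK.
  by rewrite [LHS]mxE [RHS]mxE mulrC.
Qed.
End Adjoint.
Local Notation "A ^†" := (adjmx A).

(** * Generators of quantum dynamical semigroups *)

Section Generator.
Variables (F : numClosedFieldType) (n : nat) (K : 'M[F]_n) (hs : seq 'M[F]_n).
Implicit Types X Y S G T E P Q A : 'M[F]_n.

Definition gksl X := K *m X + X *m K^† + \sum_(h <- hs) h *m X *m h^†.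

Lemma gkslP a X Y : gksl (a *: X + Y) = a *: gksl X + gksl Y.
Proof.
rewrite /gksl (eq_bigr (fun h => a *: (h *m X *m h^†) + h *m Y *m h^†)).
  rewrite big_split /= -scaler_sumr mulmxDr mulmxDl -scalemxAr -scalemxAl.
  by rewrite !scalerDr [RHS]addrACA; congr (_ + _); exact: addrACA.
by move=> h _; rewrite mulmxDr mulmxDl -scalemxAr -scalemxAl.
Qed.

HB.instance Definition _ := GRing.isLinear.Build F 'M[F]_n 'M[F]_n _ gksl gkslP.

Lemma gksl_adj X : (gksl X)^† = gksl (X^†).
Proof.
rewrite /gksl !adjmxD adjmx_sum !adjmxM adjmxK [in LHS](addrC (_ *m _)).
by congr (_ + _); apply: eq_bigr => h _; rewrite !adjmxM adjmxK mulmxA.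
Qed.

Lemma gksl_sandwich P Q X : P *m gksl X *m Q =
  P *m K *m X *m Q + P *m X *m K^† *m Q +
  \sum_(h <- hs) P *m h *m X *m h^† *m Q.
Proof.
rewrite /gksl !mulmxDr !mulmxDl mulmx_sumr mulmx_suml !mulmxA.
by congr (_ + _); apply: eq_bigr => h _; rewrite !mulmxA.
Qed.

(** Both terms in [K] contain [Q *m S] or [S *m Q] and vanish; each jump term that remains has the
    form [B *m B^†]. *)
Lemma gksl_corner Q S : Q^† = Q -> S^† = S -> Q *m S = 0 ->
  Q *m gksl (S *m S) *m Q = \sum_(h <- hs) (Q *m h *m S) *m (Q *m h *m S)^†.
Proof.
move=> Qh Sh QS; have SQ : S *m Q = 0 by rewrite -Qh -Sh -adjmxM QS adjmx0.
rewrite gksl_sandwich !mulmxA QS !mul0mx -[_ *m S *m Q]mulmxA SQ mulmx0 !add0r.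
by apply: eq_bigr => h _; rewrite !adjmxM Qh Sh !mulmxA.
Qed.

Lemma gksl_corner_ge0 Q S : Q^† = Q -> S^† = S -> Q *m S = 0 ->
  0 <= \tr (Q *m gksl (S *m S) *m Q).
Proof.
move=> *; rewrite gksl_corner // raddf_sum.
by apply: sumr_ge0 => h _; apply: mxtrace_mul_adj_ge0.
Qed.

Lemma gksl_corner_eq0 Q S : Q^† = Q -> S^† = S -> Q *m S = 0 ->
  \tr (Q *m gksl (S *m S) *m Q) = 0 -> {in hs, forall h, Q *m h *m S = 0}.
Proof.
move=> ? ? ?; rewrite gksl_corner // raddf_sum => /eqP.
rewrite psumr_eq0; last by move=> h _; apply: mxtrace_mul_adj_ge0.
by move=> /allP s0 h /s0 /eqP; apply: mxtrace_mul_adj_eq0.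
Qed.

(** * The range projector of a Hermitian matrix with a pseudo-inverse *)

Section Projector.
Variables S G : 'M[F]_n.
Hypotheses (Sh : S^† = S) (Gh : G^† = G) (SGS : S *m G *m S = S).
Hypothesis (SG : S *m G = G *m S).
Let P := S *m G.

Lemma rangeproj_adj : P^† = P. Proof. by rewrite adjmxM Sh Gh -SG. Qed.
Lemma rangeproj_idem : P *m P = P. Proof. by rewrite /P mulmxA SGS. Qed.
Lemma rangeproj_mull : P *m S = S. Proof. exact: SGS. Qed.
Lemma rangeproj_mulr : S *m P = S. Proof. by rewrite /P SG mulmxA SGS. Qed.
(** Factors [P] through [S *m S], so that whatever kills [S *m S] from the left kills [P]. *)
Lemma rangeproj_sqr : P = S *m S *m (G *m G).
Proof. by rewrite -{1}rangeproj_idem /P -mulmxA (mulmxA G S) -SG !mulmxA. Qed.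
Lemma rangeproj_inv_sqr : P = G *m G *m (S *m S).
Proof. by rewrite -{1}rangeproj_idem /P SG -mulmxA (mulmxA S G) SG !mulmxA. Qed.

Lemma rangeproj_compl : (1%:M - P) *m S = 0 /\ S *m (1%:M - P) = 0.
Proof. by rewrite mulmxBl mulmxBr mul1mx mulmx1 rangeproj_mull rangeproj_mulr subrr. Qed.
End Projector.

Hypothesis K_hs : K + K^† = - \sum_(h <- hs) h^† *m h.

(** By cyclicity the trace is that of [(K + K^† + sum h^† h) X], where the first factor is 0 by
    [K_hs]. *)
Lemma gksl_trace X : \tr (gksl X) = 0.
Proof.
rewrite /gksl !raddfD raddf_sum /= (mxtrace_mulC X).
rewrite (eq_bigr (fun h => \tr (h^† *m h *m X))).
  by rewrite -raddf_sum -mulmx_suml -!raddfD -!mulmxDl K_hs addNr mul0mx raddf0.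
by move=> h _; rewrite mxtrace_mulC mulmxA.
Qed.

Lemma compl_adj P : P^† = P -> (1%:M - P)^† = 1%:M - P.
Proof. by move=> Ph; rewrite adjmxD adjmx1 adjmxN Ph. Qed.

Lemma tr_sandwich P X : P *m P = P -> \tr (P *m X *m P) = \tr (P *m X).
Proof. by move=> PP; rewrite mxtrace_mulC mulmxA PP. Qed.

Lemma compl_idem P : P *m P = P -> (1%:M - P) *m (1%:M - P) = 1%:M - P.
Proof. by move=> PP; rewrite mulmxBl mul1mx mulmxBr PP mulmx1 subrr subr0. Qed.

Lemma posneg_partsN X S G T E :
  posneg_parts X S G T E -> posneg_parts (- X) T E S G.
Proof.
move=> [[Sh Gh Th Eh] [-> ST ? ?]]; do 2 split => //; first by rewrite opprB.
by rewrite -Sh -Th -adjmxM ST adjmx0.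
Qed.

(* The trace of [gksl (S *m S)] vanishes, so its corner outside the range of S
   and the corner of [gksl (T *m T)] in the range of S are positive with
   opposite traces. *)
Lemma posneg_corners X S G T E : posneg_parts X S G T E -> gksl X = 0 ->
  \tr ((1%:M - S *m G) *m gksl (S *m S) *m (1%:M - S *m G)) = 0 /\
  \tr (S *m G *m gksl (T *m T) *m (S *m G)) = 0.
Proof.
move=> [[Sh Gh Th Eh] [-> ST [SGS SG] [TET TE]]] /eqP.
rewrite linearB subr_eq0 => /eqP ST_eq.
have Ph := rangeproj_adj Sh Gh SG; have PP := rangeproj_idem SGS.
have PT : S *m G *m T = 0 by rewrite SG -mulmxA ST mulmx0.
have [QS _] := rangeproj_compl SGS SG.
have tr0 : \tr ((1%:M - S *m G) *m gksl (S *m S) *m (1%:M - S *m G)) +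
           \tr (S *m G *m gksl (T *m T) *m (S *m G)) = 0.
  rewrite !tr_sandwich ?compl_idem // -ST_eq -raddfD -mulmxDl subrK mul1mx.
  exact: gksl_trace.
have := gksl_corner_ge0 (compl_adj Ph) Sh QS; have := gksl_corner_ge0 Ph Th PT.
by move=> t1 t2; move/eqP: tr0; rewrite paddr_eq0 // => /andP[/eqP ? /eqP ?].
Qed.

Lemma gksl_posneg X S G T E : posneg_parts X S G T E -> gksl X = 0 ->
  gksl (S *m S) = 0.
Proof.
move=> XST X0; have [c1 c2] := posneg_corners XST X0.
have [[Sh Gh Th Eh] [Xe ST [SGS SG] [TET TE]]] := XST.
have TS : T *m S = 0 by rewrite -Sh -Th -adjmxM ST adjmx0.
have W2 : gksl (S *m S) = gksl (T *m T).
  by apply/eqP; rewrite -subr_eq0 -linearB /= -Xe X0.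
have [QS SQ] := rangeproj_compl SGS SG.
have := rangeproj_adj Sh Gh SG; have := rangeproj_idem SGS.
have := rangeproj_sqr TET TE; have := rangeproj_inv_sqr TET TE.
have := rangeproj_sqr SGS SG; have := rangeproj_inv_sqr SGS SG.
have PS := rangeproj_mull SGS; have TP2 := rangeproj_mulr TET TE.
have PT : S *m G *m T = 0 by rewrite SG -mulmxA ST mulmx0.
have TP : T *m (S *m G) = 0 by rewrite mulmxA TS mul0mx.
set P := S *m G in c1 c2 QS SQ PS PT TP *.
set P2 := T *m E in TP2 *; set Q := 1%:M - P in c1 c2 QS SQ *.
move=> PGS PSG PET PTE PP Ph.
have PE : P = S *m G by [].
have P2E : P2 = T *m E by [].
have Qh : Q^† = Q by apply: compl_adj.
have PP2_0 : P *m P2 = 0 by rewrite P2E mulmxA PT mul0mx.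
have QP2 : Q *m P2 = P2 by rewrite mulmxBl mul1mx PP2_0 subr0.
have TQ : T *m Q = T by rewrite mulmxBr mulmx1 TP subr0.
(* Every jump operator preserves the range of [S] ([H1]) and maps the range of [T] into the kernel
   of [P] ([H2]). *)
have H1 := gksl_corner_eq0 Qh Sh QS c1; have H2 := gksl_corner_eq0 Ph Th PT c2.
have PQ1 : P + Q = 1%:M by rewrite addrC subrK.
have hPE h : h *m P - P *m h *m P = Q *m h *m P.
  by rewrite [Q *m h]mulmxBl mulmxBl mul1mx.
clearbody Q; clearbody P P2.
set W := gksl _ in W2 c1 *.
have QWQ : Q *m W *m Q = 0.
  by rewrite gksl_corner //; apply: big1_seq => h /= hin; rewrite H1 // mul0mx.
have PWP : P *m W *m P = 0.
  rewrite W2 gksl_corner //; apply: big1_seq => h /= hin.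
  by rewrite H2 // mul0mx.
(* The diagonal blocks of [W] are 0. The off-diagonal block is computed twice: [A1] from [S *m S]
   leaves only a [K^†] term, [A2] from [T *m T] only a [K] term. *)
pose A := P *m W *m Q.
have A1 : A = S *m S *m K^† *m Q.
  rewrite /A /W gksl_sandwich [X in _ + X]big1_seq; last first.
    move=> h /= hin; rewrite -!mulmxA (_ : S *m (h^† *m Q) = 0) ?mulmx0 //.
    by rewrite -Qh -Sh mulmxA -!adjmxM mulmxA H1 // adjmx0.
  by rewrite !mulmxA PS -[_ *m S *m Q]mulmxA SQ mulmx0 add0r addr0.
have A2 : A = P *m K *m (T *m T).
  rewrite /A W2 gksl_sandwich [X in _ + X]big1_seq; last first.
    by move=> h /= hin; rewrite !mulmxA H2 // !mul0mx.
  rewrite !mulmxA PT !mul0mx !addr0 -(mulmxA _ T Q).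
  by rewrite TQ -mulmxA.
have AP2 : A *m P2 = A by rewrite A2 -!mulmxA TP2.
have PA : P *m A = A by rewrite A1 !mulmxA PS.
(* The pseudo-inverses strip the squares off [A2] and [A1], leaving the same block of [K] and of
   [K^†]. *)
have AEE : A *m (E *m E) = P *m K *m P2 by rewrite A2 -mulmxA -PTE.
have GGA : G *m G *m A = P *m K^† *m P2.
  rewrite -AP2 A1 -!mulmxA QP2.
  by rewrite (mulmxA S S) (mulmxA G) (mulmxA (G *m G)) -PGS.
(* The sum is [P (K + K^†) P2 = - sum P h^† h P2]; here [P h^† = P h^† P] by [H1], and [P h P2 = 0]
   by [H2]. *)
have sylvester : A *m (E *m E) + G *m G *m A = 0.
  rewrite AEE GGA -mulmxDl -mulmxDr K_hs mulmxN mulNmx mulmx_sumr mulmx_suml.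
  rewrite big1_seq ?oppr0 // => h /= hin.
  have hP : h *m P = P *m h *m P.
    apply/eqP; rewrite -subr_eq0 hPE.
    by rewrite PE mulmxA H1 // mul0mx.
  have Ph_ : P *m h^† = P *m h^† *m P.
    by rewrite -{1}Ph -adjmxM hP !adjmxM Ph mulmxA.
  by rewrite mulmxA Ph_ -!mulmxA (mulmxA P h) P2E (mulmxA _ T) H2 // mul0mx !mulmx0.
have AE : A = P *m W *m Q by []; clearbody A.
have SA : S *m A = 0.
  (* Multiplying by [S *m S] and [T *m T] turns the equation into [S S A + A T T = 0]; its trace
     against [A^†] is the sum of the squared norms of [S *m A] and [A *m T]. *)
  have := congr1 (fun Z => \tr (S *m S *m Z *m (T *m T) *m A^†)) sylvester.
  rewrite mulmx0 !mul0mx mxtrace0 mulmxDr !mulmxDl raddfD /=.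
  rewrite (_ : S *m S *m (A *m (E *m E)) *m (T *m T) = S *m S *m A); last first.
    by rewrite -!mulmxA (mulmxA E E) -PET AP2.
  rewrite (_ : S *m S *m (G *m G *m A) = A); last first.
    by rewrite (mulmxA (S *m S)) -PSG PA.
  have -> : \tr (S *m S *m A *m A^†) = \tr ((S *m A) *m (S *m A)^†).
    by rewrite adjmxM Sh mulmxA [RHS]mxtrace_mulC !mulmxA.
  have -> : \tr (A *m (T *m T) *m A^†) = \tr ((A *m T) *m (A *m T)^†).
    by rewrite adjmxM Th !mulmxA.
  move=> /eqP; rewrite paddr_eq0 ?mxtrace_mul_adj_ge0 // => /andP[/eqP + _].
  exact: mxtrace_mul_adj_eq0.
have A0 : A = 0 by rewrite -PA PE SG -mulmxA SA mulmx0.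
have Wh : W^† = W by rewrite /W gksl_adj adjmxM Sh.
have QWP : Q *m W *m P = 0.
  by rewrite -Qh -Ph -Wh -!adjmxM mulmxA -AE A0 adjmx0.
have Wl Z : Z = P *m Z + Q *m Z by rewrite -mulmxDl PQ1 mul1mx.
have Wr Z : Z = Z *m P + Z *m Q by rewrite -mulmxDr PQ1 mulmx1.
by rewrite [W]Wl [P *m W]Wr [Q *m W]Wr PWP -AE A0 QWP QWQ !addr0.
Qed.

(** The infinitesimal counterpart of [collecting]: the generator maps the corner of [P] into
    itself. *)
Definition gksl_invariant P := forall Y,
  P *m gksl (P *m Y *m P) *m P = gksl (P *m Y *m P).

(** The corner identity gives [Q h S = 0] for all jump operators, with [Q = 1 - P]. Then
    [Q *m gksl (S *m S) = 0] reduces to [Q K S S = 0], hence [Q K P = 0]. So [Q] kills the image of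
    the corner from the left, and by adjunction from the right. *)
Lemma stationary_support_invariant S G :
  S^† = S -> G^† = G -> S *m G *m S = S -> S *m G = G *m S ->
  gksl (S *m S) = 0 -> gksl_invariant (S *m G).
Proof.
move=> Sh Gh SGS SG S0 Y; have [QS SQ] := rangeproj_compl SGS SG.
have Ph := rangeproj_adj Sh Gh SG; have PP := rangeproj_idem SGS.
have PS := rangeproj_mull SGS; have PE := rangeproj_sqr SGS SG.
set P := S *m G in QS SQ Ph PP PS PE *; set Q := 1%:M - P in QS SQ.
have Qh : Q^† = Q by apply: compl_adj.
have QP : Q *m P = 0 by rewrite mulmxBl mul1mx PP subrr.
have QE Z : Z - P *m Z = Q *m Z by rewrite mulmxBl mul1mx.
clearbody Q; clearbody P.
have H1 : {in hs, forall h, Q *m h *m S = 0}.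
  by apply: gksl_corner_eq0; rewrite // S0 mulmx0 mul0mx mxtrace0.
have KP : Q *m K *m P = 0.
  have := congr1 (fun Z => Q *m Z *m 1%:M) S0.
  rewrite /= gksl_sandwich mulmx0 mul0mx !mulmxA QS !mul0mx addr0 !mulmx1.
  rewrite big1_seq => [|h /= hin]; last by rewrite !mulmxA H1 // !mul0mx.
  by rewrite addr0 => KSS; rewrite PE !mulmxA KSS !mul0mx.
have QL Z : Q *m gksl (P *m Z *m P) = 0.
  rewrite -[LHS]mulmx1 gksl_sandwich !mulmxA KP QP !mul0mx !add0r.
  by rewrite big1_seq // => h /= hin; rewrite PE !mulmxA H1 // !mul0mx.
have LP Z : P *m gksl (P *m Z *m P) = gksl (P *m Z *m P).
  by apply/eqP; rewrite eq_sym -subr_eq0 QE QL.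
rewrite LP -[gksl _]adjmxK gksl_adj !adjmxM Ph mulmxA.
by rewrite -[X in _ *m X = _]Ph -adjmxM LP.
Qed.
End Generator.

(** * Minimal invariant corners *)

Section MinimalInvariant.
Variables (F : numClosedFieldType) (n : nat) (K : 'M[F]_n) (hs : seq 'M[F]_n).
Hypothesis K_hs : K + K^† = - \sum_(h <- hs) h^† *m h.
Implicit Types X Y S G T E P Q A : 'M[F]_n.
Local Notation L := (gksl K hs).

Definition psdmx A := forall x : 'cV[F]_n, 0 <= (x^† *m A *m x) 0 0.

Definition densitymx A := [/\ A^† = A, psdmx A & \tr A = 1].

Lemma psdmx_sqr S : S^† = S -> psdmx (S *m S).
Proof.
move=> Sh x; rewrite mulmxA -mulmxA -{1}Sh -adjmxM mxE.
by apply: sumr_ge0 => k _; rewrite adjmxE mulrC mul_conjC_ge0.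
Qed.

Lemma psdmxZ a A : 0 <= a -> psdmx A -> psdmx (a *: A).
Proof. by move=> a0 Ap x; rewrite -scalemxAr -scalemxAl mxE mulr_ge0. Qed.

Section Minimal.
Variable P : 'M[F]_n.
Hypotheses (Ph : P^† = P) (PP : P *m P = P) (P0 : P != 0).
Hypothesis P_inv : gksl_invariant K hs P.
Hypothesis P_min : forall Q, Q^† = Q -> Q *m Q = Q -> P *m Q = Q ->
  gksl_invariant K hs Q -> Q = 0 \/ Q = P.

(** As [T *m S = 0], [X S] is the cube of [S], so [S = X S G G] has its range in that of [X]. *)
Lemma posneg_sub X S G T E : posneg_parts X S G T E -> X = P *m X *m P ->
  P *m S = S.
Proof.
move=> [[Sh Gh Th Eh] [Xe ST [SGS SG] [TET TE]]] XP.
have TS : T *m S = 0 by rewrite -Sh -Th -adjmxM ST adjmx0.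
have PX : P *m X = X by rewrite XP !mulmxA PP.
have XS : X *m S = S *m S *m S by rewrite Xe mulmxBl -(mulmxA T) TS mulmx0 subr0.
have S2 : S = S *m S *m G by rewrite -mulmxA SG mulmxA SGS.
have Se : S = S *m S *m S *m (G *m G).
  suff -> : S *m S *m S *m (G *m G) = (S *m S *m G) *m S *m G by rewrite -!S2.
  by rewrite -(mulmxA (S *m S) G S) -SG !mulmxA.
by rewrite {1}Se -XS !mulmxA PX XS -mulmxA -Se.
Qed.

Lemma minimal_support X S G T E : posneg_parts X S G T E -> X = P *m X *m P ->
  L X = 0 -> S = 0 \/ S *m G = P.
Proof.
move=> XST XP LX; have PS := posneg_sub XST XP.
have LS := gksl_posneg K_hs XST LX.
have [[Sh Gh Th Eh] [Xe ST [SGS SG] [TET TE]]] := XST.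
case: (P_min (rangeproj_adj Sh Gh SG) (rangeproj_idem SGS)).
- by rewrite mulmxA PS.
- exact: stationary_support_invariant.
- by move=> SG0; left; rewrite -SGS SG0 mul0mx.
- by right.
Qed.

(** If one part vanishes, [X] or [-X] is a square of trace 0. Otherwise both range projectors equal
    [P] although their product is 0, which contradicts [P != 0]. *)
Lemma stationary_traceless_eq0 X : X^† = X -> X = P *m X *m P -> L X = 0 ->
  \tr X = 0 -> X = 0.
Proof.
move=> Xh XP LX trX; have [S [G [T [E XST]]]] := posneg_parts_exists Xh.
have XSTN := posneg_partsN XST.
have := minimal_support XST XP LX; have := minimal_support XSTN.
rewrite mulmxN mulNmx -XP linearN /= LX oppr0 => /(_ erefl erefl).
have [[Sh Gh Th Eh] [Xe ST [SGS SG] [TET TE]]] := XST.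
have sq0 A : A^† = A -> \tr (A *m A) = 0 -> A *m A = 0.
  by move=> Ah; rewrite -{2}Ah => /mxtrace_mul_adj_eq0 ->; rewrite mul0mx.
move=> [T0|TP] [S0|SP].
- by rewrite Xe S0 T0 mul0mx subrr.
- rewrite Xe T0 mul0mx subr0; apply: sq0 => //.
  by rewrite -trX Xe T0 mul0mx subr0.
- rewrite Xe S0 mul0mx sub0r sq0 ?oppr0 //.
  by move/eqP: trX; rewrite Xe S0 mul0mx sub0r raddfN oppr_eq0 => /eqP.
- by case/eqP: P0; rewrite -PP -{1}SP -TP SG mulmxA -(mulmxA G) ST mulmx0 mul0mx.
Qed.

(* Otherwise X |-> L (P X P) + (X - P X P) would be onto, and P would be of the
   form L (P X P), hence traceless. *)
Lemma stationary_exists : exists2 X, X != 0 & X = P *m X *m P /\ L X = 0.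
Proof.
pose g X := L (P *m X *m P) + (X - P *m X *m P).
have g_lin a X Y : g (a *: X + Y) = a *: g X + g Y.
  rewrite /g !mulmxDr !mulmxDl -!scalemxAr -!scalemxAl linearP /=.
  rewrite !scalerDr scalerN [RHS]addrACA; congr (_ + _).
  by rewrite opprD addrACA.
pose gl := GRing.isLinear.Build F 'M[F]_n 'M[F]_n _ g g_lin.
pose gL : {linear 'M[F]_n -> 'M[F]_n} := HB.pack g gl.
have PgP X : P *m g X *m P = L (P *m X *m P).
  rewrite /g mulmxDr mulmxDl P_inv mulmxBr mulmxBl !mulmxA PP -!mulmxA PP.
  by rewrite subrr addr0.
have [gU|gN] := boolP (row_free (lin_mx gL)).
  pose X := vec_mx (mxvec P *m invmx (lin_mx gL)).
  have gX : g X = P.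
    apply: (can_inj mxvecK); rewrite -[g]/(gL : _ -> _) -mul_vec_lin vec_mxK.
    by rewrite mulmxKV // -row_free_unit.
  have := PgP X; rewrite gX !PP => PL.
  (* The trace of [P] is that of [P *m P^†], so a traceless projector is 0. *)
  have := gksl_trace K_hs (P *m X *m P); rewrite -PL -{1}PP -{2}Ph.
  by move=> /mxtrace_mul_adj_eq0 P00; case/eqP: P0.
move: gN; rewrite -kermx_eq0 => /rowV0Pn[v /sub_kermxP vg v0].
have gX : g (vec_mx v) = 0.
  apply: (can_inj mxvecK); rewrite -[g]/(gL : _ -> _) -mul_vec_lin vec_mxK vg.
  by rewrite linear0.
(* Compressing [g X = 0] to the corner kills the [L] term; what is left of [g X = 0] puts the kernel
   element in the corner. *)
have LP : L (P *m vec_mx v *m P) = 0 by rewrite -PgP gX mulmx0 mul0mx.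
have XP : vec_mx v = P *m vec_mx v *m P.
  by apply/eqP; rewrite -subr_eq0 -[X in X == 0]add0r -{1}LP; apply/eqP.
exists (vec_mx v); last by rewrite -XP in LP.
by apply: contraNneq v0 => v0; rewrite -[v]vec_mxK v0 linear0.
Qed.

(** Take [X + X^†]; if this is 0, then [X] is skew-Hermitian and ['i *: X] serves. *)
Lemma stationary_hermitian_exists :
  exists2 X, X != 0 & [/\ X^† = X, X = P *m X *m P & L X = 0].
Proof.
have [X X0 [XP LX]] := stationary_exists.
have XaP : X^† = P *m X^† *m P by rewrite {1}XP !adjmxM Ph mulmxA.
have LXa : L X^† = 0 by rewrite -gksl_adj LX adjmx0.
have [XX|XX] := eqVneq (X + X^†) 0; last first.
  exists (X + X^†) => //; split.
  - by rewrite adjmxD adjmxK addrC.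
  - by rewrite mulmxDr mulmxDl -XP -XaP.
  - by rewrite linearD /= LX LXa addr0.
exists ('i *: X); first by rewrite scaler_eq0 negb_or neq0Ci.
split; last by rewrite linearZ /= LX scaler0.
- by rewrite adjmxZ conjCi scaleNr -scalerN; congr (_ *: _); apply/eqP;
     rewrite eq_sym -subr_eq0 opprK XX.
- by rewrite -scalemxAr -scalemxAl -XP.
Qed.

(** The factorisation [P = rho *m G] expresses that [rho] has full rank in the corner. The state is
    the normalised square of whichever of [S] and [T] is nonzero. *)
Theorem minimal_invariant_stationary :
  exists rho : 'M[F]_n, [/\ densitymx rho, rho = P *m rho *m P, L rho = 0,
    exists G, P = rho *m G &
    forall rho', densitymx rho' -> rho' = P *m rho' *m P -> L rho' = 0 ->
      rho' = rho].
Proof.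
have [S [G [Sh [[Gh SGS SG] [S0 PS LS]]]]] : exists S G, S^† = S /\
  [/\ G^† = G, S *m G *m S = S & S *m G = G *m S] /\
  [/\ S != 0, P *m S = S & L (S *m S) = 0].
  have [X X0 [Xh XP LX]] := stationary_hermitian_exists.
  have [S [G [T [E XST]]]] := posneg_parts_exists Xh.
  have XSTN := posneg_partsN XST.
  have [[Sh Gh Th Eh] [Xe ST [SGS SG] [TET TE]]] := XST.
  have [S0|S0] := eqVneq S 0.
    exists T, E; split=> //; split; split=> //.
    - by apply: contraNneq X0 => T0; rewrite Xe S0 T0 mul0mx subrr.
    - by apply: (posneg_sub XSTN); rewrite mulmxN mulNmx -XP.
    - by apply: (gksl_posneg K_hs XSTN); rewrite linearN /= LX oppr0.
  exists S, G; split=> //; split; split=> //; first exact: posneg_sub XST XP.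
  exact: (gksl_posneg K_hs XST).
have SP : S *m P = S by rewrite -{1}Sh -Ph -adjmxM PS.
have SGP : S *m G = P.
  case: (P_min (rangeproj_adj Sh Gh SG) (rangeproj_idem SGS)) => //.
  - by rewrite mulmxA PS.
  - exact: stationary_support_invariant.
  - by move=> SG0; case/eqP: S0; rewrite -SGS SG0 mul0mx.
pose c := \tr (S *m S).
have cE : c = \tr (S *m S^†) by rewrite Sh.
have c_gt0 : 0 < c.
  rewrite lt_neqAle cE mxtrace_mul_adj_ge0 andbT eq_sym.
  by apply: contraNneq S0 => /mxtrace_mul_adj_eq0 ->.
pose rho := c^-1 *: (S *m S).
have rhoD : densitymx rho.
  split.
  - by rewrite adjmxZ adjmxM Sh geC0_conj // invr_ge0 ltW.
  - by apply: psdmxZ; [rewrite invr_ge0 ltW | apply: psdmx_sqr].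
  - by rewrite mxtraceZ mulVf // gt_eqF.
have rhoP : rho = P *m rho *m P.
  by rewrite -scalemxAr -scalemxAl mulmxA PS -mulmxA SP.
have Lrho : L rho = 0 by rewrite linearZ /= LS scaler0.
exists rho; split=> //.
  exists (c *: (G *m G)); rewrite -scalemxAr -scalemxAl scalerA mulfV ?gt_eqF //.
  by rewrite scale1r -(rangeproj_sqr SGS SG).
(* The difference of two stationary states is Hermitian, stationary and traceless. *)
move=> rho' [h' p' t'] P' L'; have [h p t] := rhoD.
apply/eqP; rewrite -subr_eq0; apply/eqP; apply: stationary_traceless_eq0.
- by rewrite adjmxD adjmxN h h'.
- by rewrite mulmxBr mulmxBl -P' -rhoP.
- by rewrite linearB /= L' Lrho subrr.
- by rewrite raddfB /= t' t subrr.
Qed.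
End Minimal.
End MinimalInvariant.

(** * Entrywise bounds for linear maps on matrices *)

Section LinearMaps.
Variables (F : numDomainType) (n : nat).

Lemma linear_entry (f : {linear 'M[F]_n -> 'M[F]_n}) Z i j :
  f Z i j = \sum_k \sum_l Z k l * f (delta_mx k l) i j.
Proof.
rewrite {1}(matrix_sum_delta Z) linear_sum summxE; apply: eq_bigr => k _.
by rewrite linear_sum summxE; apply: eq_bigr => l _; rewrite linearZ mxE.
Qed.

(** Boundedness in the maximum norm; the constant sums the moduli of all entries of the images of
    the matrix units. *)
Lemma linear_bounded (f : {linear 'M[F]_n -> 'M[F]_n}) :
  exists2 c, 0 <= c & forall (Z : 'M[F]_n) b, (forall i j, `|Z i j| <= b) ->
    forall i j, `|f Z i j| <= c * b.
Proof.
pose d i j := \sum_k \sum_l `|f (delta_mx k l) i j|.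
have d0 i j : 0 <= d i j by do 2 apply: sumr_ge0 => ? _.
exists (\sum_i \sum_j d i j) => [|Z b Zb i j]; first by do 2 apply: sumr_ge0 => ? _.
have b0 : 0 <= b by apply: le_trans (Zb i j).
have dle : d i j <= \sum_i \sum_j d i j.
  rewrite (bigD1 i) //= (bigD1 j) //= -addrA lerDl addr_ge0 ?sumr_ge0 // => k _.
  by rewrite sumr_ge0.
apply: le_trans (ler_wpM2r b0 dle); rewrite linear_entry mulr_suml.
apply: le_trans (ler_norm_sum _ _ _) _; apply: ler_sum => k _.
rewrite mulr_suml; apply: le_trans (ler_norm_sum _ _ _) _; apply: ler_sum => l _.
by rewrite normrM mulrC ler_wpM2l.
Qed.
End LinearMaps.

(** * The Lindblad generator in drift and jump form *)

Section Drift.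
Variables (F : numClosedFieldType) (n : nat) (H : 'M[F]_n) (hs : seq 'M[F]_n).

(** This is [-i] times the effective non-Hermitian Hamiltonian [H - (i/2) sum h^† h]. *)
Definition drift := - 'i *: H - 2^-1 *: \sum_(h <- hs) h^† *m h.

Hypothesis Hh : H^† = H.

Lemma drift_adj : drift^† = 'i *: H - 2^-1 *: \sum_(h <- hs) h^† *m h.
Proof.
rewrite adjmxD adjmxN !adjmxZ rmorphN /= conjCi opprK Hh adjmx_sum.
rewrite geC0_conj ?invr_ge0 ?ler0n //; congr (_ - _ *: _).
by apply: eq_bigr => h _; rewrite adjmxM adjmxK.
Qed.

Lemma drift_dissipation : drift + drift^† = - \sum_(h <- hs) h^† *m h.
Proof.
rewrite drift_adj addrACA -scalerDl addNr scale0r add0r -opprD -scalerDl.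
by rewrite -[2^-1]div1r -splitr scale1r.
Qed.

Lemma gksl_driftE X : gksl drift hs X =
  - 'i *: (H *m X - X *m H) +
  \sum_(h <- hs) (h *m X *m h^† - 2^-1 *: (h^† *m h *m X + X *m (h^† *m h))).
Proof.
rewrite sumrB -scaler_sumr big_split /= -mulmx_suml -mulmx_sumr.
rewrite /gksl drift_adj mulmxBl mulmxBr -!scalemxAl -!scalemxAr scalerBr.
rewrite scalerDr opprD !scaleNr opprK [in RHS](addrC (\sum_(h <- hs) _)) !addrA.
by do 2 congr (_ + _); rewrite addrAC.
Qed.
End Drift.

(** * Translation from Defs *)

Local Notation RC := (complex R).
Local Notation Re := (@complex.Re R).
Local Notation Im := (@complex.Im R).

Definition cplx (z : Defs.C) : RC := Complex z.1 z.2.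
Definition uncplx (z : RC) : Defs.C := (Re z, Im z).

Lemma uncplxK z : cplx (uncplx z) = z. Proof. by case: z. Qed.
Lemma cplxK z : uncplx (cplx z) = z. Proof. by case: z. Qed.

Lemma cplx_inj : injective cplx. Proof. exact: can_inj cplxK. Qed.

Lemma cplxD z w : cplx (Cadd z w) = cplx z + cplx w. Proof. by []. Qed.
Lemma cplxN z : cplx (Copp z) = - cplx z. Proof. by []. Qed.
Lemma cplxM z w : cplx (Cmul z w) = cplx z * cplx w. Proof. by []. Qed.
Lemma cplxJ z : cplx (Cconj z) = (cplx z)^*. Proof. by []. Qed.
Lemma cplx_i : cplx Ci = 'i. Proof. by rewrite -complexiE. Qed.

Lemma cplx_half : cplx (RtoC (/ 2)) = 2^-1.
Proof.
have -> : cplx (RtoC (/ 2)) = real_complex R (2^-1) by [].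
by rewrite fmorphV rmorph_nat.
Qed.

Lemma cplx_sum m f : cplx (Csum m f) = \sum_(i < m) cplx (f i).
Proof. by elim: m => [|m IH]; rewrite ?big_ord0 // big_ord_recr /= cplxD IH. Qed.

Section Bridge.
Variable n : nat.
Implicit Types (A B X : Mat) (Z : 'M[RC]_n).

Definition tomx A : 'M[RC]_n := \matrix_(i, j) cplx (A i j).
Definition tocv (x : Vec) : 'cV[RC]_n := \col_i cplx (x i).

(** Entries outside the [n] by [n] block default to [C0]; [meq n] does not see them. *)
Definition ofmx Z : Mat := fun i j =>
  if (insub i, insub j) is (Some i', Some j') then uncplx (Z i' j') else C0.
Definition ofcv (x : 'cV[RC]_n) : Vec := fun i =>
  if insub i is Some i' then uncplx (x i' 0) else C0.

Lemma ofmxK Z : tomx (ofmx Z) = Z.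
Proof. by apply/matrixP => i j; rewrite mxE /ofmx !valK uncplxK. Qed.

Lemma ofcvK x : tocv (ofcv x) = x.
Proof. by apply/colP => i; rewrite mxE /ofcv valK uncplxK. Qed.

Lemma tomx_eqP A B : meq n A B <-> tomx A = tomx B.
Proof.
split=> [AB|/matrixP AB i j /ssrnat.ltP lti /ssrnat.ltP ltj].
  by apply/matrixP => i j; rewrite !mxE AB //; apply/ssrnat.ltP.
by have := AB (Ordinal lti) (Ordinal ltj); rewrite !mxE => /cplx_inj.
Qed.

Lemma tocv_eqP x y : veq n x y <-> tocv x = tocv y.
Proof.
split=> [xy|/colP xy i /ssrnat.ltP lti].
  by apply/colP => i; rewrite !mxE xy //; apply/ssrnat.ltP.
by have := xy (Ordinal lti); rewrite !mxE => /cplx_inj.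
Qed.

Lemma tomx0 : tomx Mzero = 0.
Proof. by apply/matrixP => i j; rewrite !mxE. Qed.

Lemma tomxD A B : tomx (Madd A B) = tomx A + tomx B.
Proof. by apply/matrixP => i j; rewrite !mxE -cplxD. Qed.

Lemma tomxB A B : tomx (Msub A B) = tomx A - tomx B.
Proof. by apply/matrixP => i j; rewrite !mxE -cplxN -cplxD. Qed.

Lemma tomxZ c A : tomx (Mscal c A) = cplx c *: tomx A.
Proof. by apply/matrixP => i j; rewrite !mxE -cplxM. Qed.

Lemma tomxM A B : tomx (Mmul n A B) = tomx A *m tomx B.
Proof.
apply/matrixP => i j; rewrite !mxE cplx_sum; apply: eq_bigr => k _.
by rewrite cplxM !mxE.
Qed.

Lemma tomx_adj A : tomx (Madj A) = (tomx A)^†.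
Proof. by apply/matrixP => i j; rewrite adjmxE !mxE -cplxJ. Qed.

Lemma tocv_apply A x : tocv (Mapply n A x) = tomx A *m tocv x.
Proof.
apply/colP => i; rewrite !mxE cplx_sum; apply: eq_bigr => k _.
by rewrite cplxM !mxE.
Qed.

Lemma tomx_tr A : \tr (tomx A) = cplx (Mtrace n A).
Proof. by rewrite cplx_sum; apply: eq_bigr => i _; rewrite mxE. Qed.

Lemma hermitianE A : hermitian n A <-> (tomx A)^† = tomx A.
Proof. by rewrite -tomx_adj -tomx_eqP. Qed.

Lemma orth_projE A :
  orth_proj n A <-> (tomx A)^† = tomx A /\ tomx A *m tomx A = tomx A.
Proof. by rewrite /orth_proj hermitianE tomx_eqP tomxM. Qed.

Lemma quadformE A x :
  cplx (Csum n (fun i => Cmul (Cconj (x i)) (Mapply n A x i))) =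
  ((tocv x)^† *m tomx A *m tocv x) 0 0.
Proof.
rewrite -mulmxA -tocv_apply mxE cplx_sum; apply: eq_bigr => i _.
by rewrite cplxM adjmxE !mxE -cplxJ.
Qed.

Lemma densityE A : density n A <-> densitymx (tomx A).
Proof.
split=> [[/hermitianE Ah [Ap At]]|[Ah Ap At]]; split => //.
- move=> x; rewrite -[x]ofcvK -quadformE; set q := Csum _ _.
  (* [psd] bounds only the real part of the quadratic form, while the order on complex numbers also
     requires it to be real; this comes from [A] being Hermitian. *)
  have qr : (cplx q)^* = cplx q.
    by rewrite quadformE -adjmxE !adjmxM adjmxK Ah mulmxA.
  rewrite lecE; apply/andP; split; last exact/RleP/Ap.
  have /(congr1 Im) /= /eqP := qr.
  by rewrite eq_sym -subr_eq0 opprK -mulr2n -mulr_natl mulf_eq0 pnatr_eq0.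
- by rewrite tomx_tr At.
- exact/hermitianE.
- split; last by apply: cplx_inj; rewrite -tomx_tr At.
  by move=> x; have := Ap (tocv x); rewrite -quadformE lecE => /andP[_ /RleP].
Qed.

Definition lindmx (H : Mat) (hs : seq Mat) : 'M[RC]_n -> 'M[RC]_n :=
  gksl (drift (tomx H) (map tomx hs)) (map tomx hs).

HB.instance Definition _ H hs := GRing.Linear.on (lindmx H hs).

Lemma LindE H hs X : hermitian n H -> tomx (Lind n H hs X) = lindmx H hs (tomx X).
Proof.
move=> /hermitianE Hh; rewrite /lindmx gksl_driftE //.
elim: hs => [|h hs IH] /=.
  by rewrite big_nil addr0 tomxZ cplxN cplx_i tomxB !tomxM.
rewrite big_cons addrCA tomxD IH addrC; congr (_ + _).
by rewrite tomxB tomxZ cplx_half tomxD !tomxM !tomx_adj.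
Qed.

Lemma Lind_iterE H hs k X : hermitian n H ->
  tomx (Lind_iter n H hs k X) = iter k (lindmx H hs) (tomx X).
Proof.
move=> Hh; elim: k => [//|k IH]; rewrite iterS -IH; exact: LindE.
Qed.

Definition exp_sum H hs t N Z :=
  \sum_(k < N.+1) real_complex R (expcoef t k) *: iter k (lindmx H hs) Z.

Lemma exp_partialE H hs t N X : hermitian n H ->
  tomx (exp_partial n H hs t N X) = exp_sum H hs t N (tomx X).
Proof.
move=> Hh; elim: N => [|N IH].
  rewrite /exp_sum big_ord1 /=.
  by rewrite /expcoef /= Rdiv_1_r scale1r.
rewrite /exp_sum big_ord_recr /= tomxD IH tomxZ; congr (_ + _ *: _).
exact: (Lind_iterE hs N.+1 X Hh).
Qed.
End Bridge.

(** * Convergence of complex sequences *)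

Definition Cun_cv (u : nat -> RC) (l : RC) :=
  Un_cv (fun N => Re (u N)) (Re l) /\ Un_cv (fun N => Im (u N)) (Im l).

Lemma ReD (x y : RC) : Re (x + y) = Re x + Re y. Proof. by case: x y => ? ? []. Qed.
Lemma ImD (x y : RC) : Im (x + y) = Im x + Im y. Proof. by case: x y => ? ? []. Qed.

Lemma ReM (x y : RC) : Re (x * y) = Re x * Re y - Im x * Im y.
Proof. by case: x y => ? ? []. Qed.

Lemma ImM (x y : RC) : Im (x * y) = Re x * Im y + Im x * Re y.
Proof. by case: x y => ? ? []. Qed.

Lemma Cun_cvD u v l m : Cun_cv u l -> Cun_cv v m ->
  Cun_cv (fun N => u N + v N) (l + m).
Proof.
move=> [ur ui] [vr vi]; split; [rewrite ReD | rewrite ImD].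
  by apply: (Un_cv_ext _ _ _ _ (CV_plus _ _ _ _ ur vr)) => N; rewrite ReD.
by apply: (Un_cv_ext _ _ _ _ (CV_plus _ _ _ _ ui vi)) => N; rewrite ImD.
Qed.

Lemma Cun_cvMr u l c : Cun_cv u l -> Cun_cv (fun N => u N * c) (l * c).
Proof.
move=> [ur ui]; have cr := Un_cv_const (Re c); have ci := Un_cv_const (Im c).
split; [rewrite ReM | rewrite ImM].
  apply: (Un_cv_ext _ _ _ _
    (CV_minus _ _ _ _ (CV_mult _ _ _ _ ur cr) (CV_mult _ _ _ _ ui ci))) => N.
  by rewrite ReM.
apply: (Un_cv_ext _ _ _ _
  (CV_plus _ _ _ _ (CV_mult _ _ _ _ ur ci) (CV_mult _ _ _ _ ui cr))) => N.
by rewrite ImM.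
Qed.

Lemma Cun_cv_sum (I : finType) (u : I -> nat -> RC) l :
  (forall i, Cun_cv (u i) (l i)) -> Cun_cv (fun N => \sum_i u i N) (\sum_i l i).
Proof.
move=> ul; elim: (index_enum I) => [|i r IH].
  split; [move: (Un_cv_const 0) | move: (Un_cv_const 0)];
    by rewrite big_nil; apply: Un_cv_ext => N; rewrite big_nil.
have [D1 D2] := Cun_cvD (ul i) IH; rewrite big_cons.
by split; [apply: Un_cv_ext D1 | apply: Un_cv_ext D2] => N; rewrite big_cons.
Qed.

Lemma Cun_cv_ext u v l : u =1 v -> Cun_cv u l -> Cun_cv v l.
Proof.
by move=> uv [D1 D2]; split; [apply: Un_cv_ext D1 | apply: Un_cv_ext D2] => N;
  rewrite uv.
Qed.

Lemma Cun_cv_uniq u l m : Cun_cv u l -> Cun_cv u m -> l = m.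
Proof.
case: l m => [lr li] [mr mi] [/= ur ui] [/= vr vi].
by rewrite (UL_sequence _ _ _ ur vr) (UL_sequence _ _ _ ui vi).
Qed.

Lemma Cun_cv_linear n (f : {linear 'M[RC]_n -> 'M[RC]_n})
    (S : nat -> 'M[RC]_n) (Y : 'M[RC]_n) :
  (forall i j, Cun_cv (fun N => S N i j) (Y i j)) ->
  forall i j, Cun_cv (fun N => f (S N) i j) (f Y i j).
Proof.
move=> SY i j; rewrite linear_entry.
apply: (@Cun_cv_ext (fun N => \sum_k \sum_l S N k l * f (delta_mx k l) i j)).
  by move=> N; rewrite [RHS]linear_entry.
apply: Cun_cv_sum => k; apply: (@Cun_cv_sum _ (fun l N => S N k l * _)) => l.
exact: Cun_cvMr.
Qed.

Lemma Rabs_Re_le z b : `|z| <= real_complex R b -> Rle (Rabs (Re z)) b.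
Proof.
move=> zb; apply/RleP; rewrite RabsE -lecR; apply: le_trans zb; exact: normc_ge_Re.
Qed.

Lemma Rabs_Im_le z b : `|z| <= real_complex R b -> Rle (Rabs (Im z)) b.
Proof.
move=> zb; rewrite -Rabs_Ropp; have -> : Ropp (Im z) = Re (z * 'i%C) by rewrite ReiNIm.
by apply: Rabs_Re_le; rewrite normrM complexiE normCi mulr1.
Qed.

(** * Collecting subspaces and invariant corners *)

Section CornerDefect.
Variables (n : nat) (P : 'M[RC]_n).

(** For idempotent [P] it vanishes exactly on the corner of [P]. Being linear, it passes through
    partial sums and limits. *)
Definition corner_defect (Z : 'M[RC]_n) := P *m Z *m P - Z.

Lemma corner_defectP a X Y :
  corner_defect (a *: X + Y) = a *: corner_defect X + corner_defect Y.
Proof.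
rewrite /corner_defect mulmxDr mulmxDl -scalemxAr -scalemxAl scalerBr.
by rewrite opprD addrACA.
Qed.

HB.instance Definition _ :=
  GRing.isLinear.Build RC 'M[RC]_n 'M[RC]_n _ corner_defect corner_defectP.
End CornerDefect.

Section Collecting.
Variables (n : nat) (H : Mat) (hs : seq Mat).
Hypothesis Hh : hermitian n H.
Local Notation L := (@lindmx n H hs).
Implicit Types (f : {linear 'M[RC]_n -> 'M[RC]_n}) (Z : 'M[RC]_n).

Lemma linear_exp_sum f t N Z i j : f (exp_sum H hs t N Z) i j =
  \sum_(k < N.+1) real_complex R (expcoef t k) * f (iter k L Z) i j.
Proof.
rewrite linear_sum summxE; apply: eq_bigr => k _.
by rewrite linearZ mxE.
Qed.

Lemma Re_exp_sum f t N Z i j : Re (f (exp_sum H hs t N Z) i j) =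
  sum_f_R0 (fun k => Rmult (expcoef t k) (Re (f (iter k L Z) i j))) N.
Proof.
rewrite linear_exp_sum sum_f_R0E big_mkord (big_morph Re ReD (erefl _)).
by apply: eq_bigr => k _; rewrite ReM mul0r subr0.
Qed.

Lemma Im_exp_sum f t N Z i j : Im (f (exp_sum H hs t N Z) i j) =
  sum_f_R0 (fun k => Rmult (expcoef t k) (Im (f (iter k L Z) i j))) N.
Proof.
rewrite linear_exp_sum sum_f_R0E big_mkord (big_morph Im ImD (erefl _)).
by apply: eq_bigr => k _; rewrite ImM mul0r addr0.
Qed.

(** Geometric growth of the iterates supplies the hypothesis of the scalar exponential series: [M]
    bounds the generator, and [B] combines a bound of [f] with the size of [Z]. *)
Lemma iter_lindmx_bound f Z : exists B M, Rle 0 M /\ forall i j k,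
  Rle (Rabs (Re (f (iter k L Z) i j))) (Rmult B (pow M k)) /\
  Rle (Rabs (Im (f (iter k L Z) i j))) (Rmult B (pow M k)).
Proof.
have [c c0 cL] := linear_bounded (lindmx H hs : {linear 'M[RC]_n -> 'M[RC]_n}).
have [d d0 df] := linear_bounded f.
pose b := \sum_i \sum_j `|Z i j|.
have b0 : 0 <= b by do 2 apply: sumr_ge0 => ? _.
have Zb i j : `|Z i j| <= b.
  rewrite /b (bigD1 i) //= (bigD1 j) //= -addrA lerDl addr_ge0 ?sumr_ge0 // => k _.
  by rewrite sumr_ge0.
have iter_b k i j : `|iter k L Z i j| <= c ^+ k * b.
  elim: k i j => [|k IH] i j; first by rewrite expr0 mul1r.
  by rewrite exprS -mulrA; apply: cL.
exists (Re (d * b)), (Re c); split.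
  by apply/RleP; move: c0; rewrite lecE => /andP[].
move=> i j k; have fb : `|f (iter k L Z) i j| <=
    real_complex R (Rmult (Re (d * b)) (pow (Re c) k)).
  rewrite RpowE RmultE rmorphM rmorphXn /= !RRe_real ?ger0_real ?mulr_ge0 //.
  by rewrite mulrAC -mulrA; apply: df.
by split; [apply: Rabs_Re_le | apply: Rabs_Im_le].
Qed.

(** [collecting] speaks only of matrices known to be limits, so a limit has to be produced before it
    can be applied. *)
Lemma exp_sum_cv t Z : Rle 0 t -> exists Y : 'M[RC]_n,
  forall i j, Cun_cv (fun N => exp_sum H hs t N Z i j) (Y i j).
Proof.
move=> t0; have [B [M [M0 BM]]] := iter_lindmx_bound idfun Z.
pose re i j := exp_series_cv _ _ _ (fun k => proj1 (BM i j k)) _ t0.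
pose im i j := exp_series_cv _ _ _ (fun k => proj2 (BM i j k)) _ t0.
exists (\matrix_(i, j) Complex (sval (re i j)) (sval (im i j))) => i j.
rewrite mxE; split.
  apply: Un_cv_ext (svalP (re i j)) => N.
  by rewrite -(Re_exp_sum idfun).
apply: Un_cv_ext (svalP (im i j)) => N.
by rewrite -(Im_exp_sum idfun).
Qed.

Lemma semigroup_imageE t X Y : is_semigroup_image n H hs t X Y <->
  forall i j, Cun_cv (fun N => exp_sum H hs t N (tomx n X) i j) (tomx n Y i j).
Proof.
have E (i j : 'I_n) N : exp_sum H hs t N (tomx n X) i j =
    cplx (exp_partial n H hs t N X i j).
  by rewrite -exp_partialE // mxE.
split=> XY.
  move=> i j; have [||re im] := XY i j; [exact/ssrnat.ltP | exact/ssrnat.ltP |].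
  by rewrite mxE; split; [apply: Un_cv_ext re | apply: Un_cv_ext im] => N; rewrite E.
move=> i j /ssrnat.ltP lti /ssrnat.ltP ltj.
have := XY (Ordinal lti) (Ordinal ltj); rewrite mxE => -[re im].
by split; [apply: Un_cv_ext re | apply: Un_cv_ext im] => N; rewrite E.
Qed.

Lemma corner_defect_cv P t Z (Y : 'M[RC]_n) :
  (forall i j, Cun_cv (fun N => exp_sum H hs t N Z i j) (Y i j)) ->
  forall i j, Cun_cv (fun N => corner_defect P (exp_sum H hs t N Z) i j)
    (corner_defect P Y i j).
Proof. exact: Cun_cv_linear. Qed.

(** All iterates of the generator stay in the corner, so every partial sum has defect 0, and so has
    the limit. *)
Lemma invariant_collecting P : tomx n P *m tomx n P = tomx n P ->
  gksl_invariant (drift (tomx n H) (map (tomx n) hs)) (map (tomx n) hs) (tomx n P) ->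
  collecting n H hs P.
Proof.
move=> PP Pinv t S Y t0 /semigroup_imageE SY; apply/tomx_eqP.
rewrite !tomxM in SY *; set Q := tomx n P in PP Pinv SY *.
have iter_inv k : exists Z, iter k L (Q *m tomx n S *m Q) = Q *m Z *m Q.
  elim: k => [|k [Z ZE]]; first by exists (tomx n S).
  by exists (L (Q *m Z *m Q)); rewrite iterS ZE; apply/esym/Pinv.
have defect0 k : corner_defect Q (iter k L (Q *m tomx n S *m Q)) = 0.
  have [Z ->] := iter_inv k.
  by rewrite /corner_defect !mulmxA PP -!mulmxA PP !mulmxA subrr.
apply/eqP; rewrite -subr_eq0; apply/eqP/matrixP => i j; rewrite [RHS]mxE.
apply: Cun_cv_uniq (corner_defect_cv Q SY i j) _.
apply: (@Cun_cv_ext (fun=> 0)); last by split; apply: Un_cv_const.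
move=> N; rewrite linear_exp_sum big1 // => k _.
by rewrite /= defect0 mxE mulr0.
Qed.

(** The defect of the exponential series is 0 for all [t > 0], and so is its constant coefficient.
    Its linear coefficient, the defect of the generator on the corner, then vanishes too, by
    [exp_series_coef1_eq0] on real and imaginary parts. *)
Lemma collecting_invariant P : tomx n P *m tomx n P = tomx n P ->
  collecting n H hs P ->
  gksl_invariant (drift (tomx n H) (map (tomx n) hs)) (map (tomx n) hs) (tomx n P).
Proof.
move=> PP Pcol Z; set Q := tomx n P in PP *.
pose X := Mmul n (Mmul n P (ofmx Z)) P.
have XE : tomx n X = Q *m Z *m Q by rewrite !tomxM ofmxK.
have defect_cv0 t i j : Rlt 0 t ->
    Cun_cv (fun N => corner_defect Q (exp_sum H hs t N (tomx n X)) i j) 0.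
  move=> t0; have [Y XY] := exp_sum_cv (tomx n X) (Rlt_le _ _ t0).
  have QY : Q *m Y *m Q = Y.
    rewrite -[Y]ofmxK -!tomxM; apply/tomx_eqP.
    by apply: (Pcol t (ofmx Z)) => //; apply/semigroup_imageE; rewrite ofmxK.
  have D0 : corner_defect Q Y i j = 0 by rewrite /corner_defect QY subrr mxE.
  by have := corner_defect_cv Q XY i j; rewrite D0.
have [B [M [M0 BM]]] := iter_lindmx_bound (corner_defect Q) (tomx n X).
have defect0 : corner_defect Q (tomx n X) = 0.
  by rewrite /corner_defect XE !mulmxA PP -!mulmxA PP !mulmxA subrr.
apply/eqP; rewrite -subr_eq0 -XE; apply/eqP/matrixP => i j; rewrite [RHS]mxE.
apply/eqP; rewrite eq_complex; apply/andP; split; apply/eqP.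
- apply: (@exp_series_coef1_eq0
    (fun k => Re (corner_defect Q (iter k L (tomx n X)) i j)) B M) => //.
  + by move=> k; have [] := BM i j k.
  + by rewrite /= defect0 mxE.
  + move=> t t0; have [cv _] := defect_cv0 t i j t0.
    by apply: Un_cv_ext cv => N; rewrite Re_exp_sum.
- apply: (@exp_series_coef1_eq0
    (fun k => Im (corner_defect Q (iter k L (tomx n X)) i j)) B M) => //.
  + by move=> k; have [] := BM i j k.
  + by rewrite /= defect0 mxE.
  + move=> t t0; have [_ cv] := defect_cv0 t i j t0.
    by apply: Un_cv_ext cv => N; rewrite Im_exp_sum.
Qed.
End Collecting.

(** * Rank as the maximal number of independent vectors in the range *)

Section Rank.
Variable n : nat.

Definition rowsmx m (vs : nat -> Vec) : 'M[RC]_(m, n) :=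
  \matrix_(k, i) cplx (vs k i).

(** Transposes appear because matrix subspaces are row spaces, whereas the range is spanned by
    columns. *)
Lemma in_rangeE A v : in_range n A v <-> ((tocv n v)^T <= (tomx n A)^T)%MS.
Proof.
split=> [[x /tocv_eqP]|/submxP[x xA]].
  by rewrite tocv_apply => <-; rewrite trmx_mul submxMl.
exists (ofcv x^T); apply/tocv_eqP; rewrite tocv_apply ofcvK.
by apply: trmx_inj; rewrite trmx_mul trmxK -xA.
Qed.

Lemma lin_indepE m vs : lin_indep n m vs <-> row_free (rowsmx m vs).
Proof.
have combE (c : nat -> Defs.C) :
    (tocv n (fun i => Csum m (fun k => Cmul (c k) (vs k i))))^T =
    (\row_(k < m) cplx (c k)) *m rowsmx m vs.
  apply/rowP => i; rewrite !mxE cplx_sum; apply: eq_bigr => k _.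
  by rewrite cplxM !mxE.
have z0 : (tocv n (fun _ => C0)) = 0 by apply/colP => i; rewrite !mxE.
split=> [ind|Vfree c /tocv_eqP c0 k /ssrnat.ltP ltk].
  rewrite -kermx_eq0; apply/rowV0P => u /sub_kermxP uV.
  have cE : \row_(k < m) cplx (ofcv u^T k) = u.
    by apply/rowP => k; have /colP/(_ k) := ofcvK u^T; rewrite !mxE.
  have c0 : forall k, (k < m)%coq_nat -> ofcv u^T k = C0.
    apply: ind; apply/tocv_eqP; apply: trmx_inj.
    by rewrite combE cE uV z0 trmx0.
  rewrite -cE; apply/rowP => k; rewrite !mxE c0 //; exact/ssrnat.ltP.
have : \row_(k < m) cplx (c k) = 0.
  by apply: (row_free_inj Vfree); rewrite -combE c0 z0 trmx0 mul0mx.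
by move/rowP/(_ (Ordinal ltk)); rewrite !mxE => ck; apply: cplx_inj.
Qed.

Lemma is_rank_mxrank A : is_rank n A (\rank (tomx n A)).
Proof.
have rowE m vs (k : 'I_m) : row k (rowsmx m vs) = (tocv n (vs k))^T.
  by apply/rowP => i; rewrite !mxE.
rewrite -mxrank_tr; split.
  pose V := row_base (tomx n A)^T.
  pose vs k : Vec := if insub k is Some k' then ofcv (row k' V)^T else fun=> C0.
  have vsE (k : 'I_(\rank (tomx n A)^T)) : (tocv n (vs k))^T = row k V.
    by rewrite /vs valK ofcvK trmxK.
  exists vs; split=> [k /ssrnat.ltP ltk|].
    rewrite in_rangeE (vsE (Ordinal ltk)).
    by apply: submx_trans (row_sub _ _) _; rewrite eq_row_base.
  apply/lin_indepE; rewrite (_ : rowsmx _ vs = V) ?row_base_free //.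
  by apply/row_matrixP => k; rewrite rowE vsE.
move=> m vs vsA /lin_indepE /eqP Vm; apply/ssrnat.leP; rewrite -Vm.
apply: mxrankS; apply/row_subP => k; rewrite rowE -in_rangeE.
by apply: vsA; apply/ssrnat.ltP.
Qed.
End Rank.

Theorem mainTheorem9 (n : nat) (H : Mat) (hs : list Mat) (P : Mat) :
  hermitian n H ->
  orth_proj n P ->
  ~ meq n P Mzero ->
  collecting n H hs P ->
  (forall Q : Mat, orth_proj n Q -> subspace_of n Q P -> collecting n H hs Q ->
     meq n Q Mzero \/ meq n Q P) ->
  exists rho : Mat,
    (density n rho /\ meq n rho (Mmul n (Mmul n P rho) P) /\
     meq n (Lind n H hs rho) Mzero) /\
    (forall rho' : Mat,
       density n rho' -> meq n rho' (Mmul n (Mmul n P rho') P) ->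
       meq n (Lind n H hs rho') Mzero -> meq n rho' rho) /\
    (exists r : nat, is_rank n rho r /\ is_rank n P r).
Proof.
move=> Hh /orth_projE[Ph PP] P0 Pcol Pmin; have /hermitianE Hadj := Hh.
have tP0 : tomx n P != 0.
  by apply/eqP => tP0; apply: P0; apply/tomx_eqP; rewrite tomx0.
(* Minimality among collecting subspaces gives minimality among invariant corners, since an
   invariant projector is collecting. *)
have tPmin Q : Q^† = Q -> Q *m Q = Q -> tomx n P *m Q = Q ->
    gksl_invariant (drift (tomx n H) (map (tomx n) hs)) (map (tomx n) hs) Q ->
    Q = 0 \/ Q = tomx n P.
  move=> Qh QQ PQ Qinv; rewrite -[Q]ofmxK -(tomx0 n).
  have [||||] := Pmin (ofmx Q); rewrite ?tomx_eqP; try by [left | right].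
  - by apply/orth_projE; rewrite ofmxK.
  - by apply/tomx_eqP; rewrite tomxM ofmxK.
  - by apply: (invariant_collecting Hh); rewrite ofmxK.
have [rho [rhoD rhoP Lrho [G PG] rho_uniq]] :=
  minimal_invariant_stationary (drift_dissipation _ Hadj) Ph PP tP0
    (collecting_invariant Hh PP Pcol) tPmin.
exists (ofmx rho); split; [|split].
- split; first by apply/densityE; rewrite ofmxK.
  by split; apply/tomx_eqP; rewrite ?LindE // ?tomxM ?tomx0 ofmxK.
- move=> rho' /densityE d' /tomx_eqP p' /tomx_eqP l'; apply/tomx_eqP.
  rewrite ofmxK; apply: (rho_uniq _ d'); first by rewrite {1}p' !tomxM.
  by rewrite -(tomx0 n) -l'; apply/esym/LindE.
- exists (\rank rho); split; first by rewrite -{2}[rho]ofmxK; apply: is_rank_mxrank.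
  (* [rho = P rho P] gives one inequality between the ranks, [P = rho G] the other. *)
  rewrite (_ : \rank rho = \rank (tomx n P)); first exact: is_rank_mxrank.
  apply/eqP; rewrite eqn_leq; apply/andP; split.
    by rewrite {1}rhoP mxrankM_maxr.
  by rewrite {1}PG mxrankM_maxl.
Qed.
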